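(* The functions $f_a$, $a\ge 2$, form exactly two equivalence classes under the relation of being eventually identical: the class of the identity map $f_2$ and the class of $f_3$. That is, $f_2$ and $f_3$ are not eventually identical, and for every integer $a\ge 2$, $f_a$ is eventually identical to $f_2$ or to $f_3$.
   Context: $\mathbb N=\{1,2,3,\dots\}$. For $a\in\mathbb N$, the function $f_a:\mathbb N\to\mathbb N$ is defined recursively by $f_a(1)=1$, $f_a(2)=a$, and, for each $n\ge 3$, $f_a(n)$ is the smallest positive integer that is not in $\{f_a(1),\dots,f_a(n-1)\}$ and is coprime with $f_a(n-1)$. In particular $f_2$ is the identity map on $\mathbb N$. Two functions $f_a$ and $f_b$ are called eventually identical if there exists $m$ (depending on $a$ and $b$) such that $f_a(n)=f_b(n)$ for all $n>m$. *)

(* Defs.v *)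
From mathcomp Require Import all_boot.

Set Implicit Arguments.
Unset Strict Implicit.
Unset Printing Implicit Defensive.

(* [admissible s k]: k may follow a sequence whose values so far, latest first,
   are listed in s. *)
Definition admissible (s : seq nat) (k : nat) : bool :=
  [&& 0 < k, k \notin s & coprime k (head 1 s)].

(* The smallest admissible k.  The number head 1 s * sumn s + 1 is admissible
   whenever all values in s are positive (next_valueP), so the bounded search
   does find a value. *)
Definition next_value (s : seq nat) : nat :=
  find (admissible s) (iota 0 (head 1 s * sumn s).+2).

(* [:: f_a(n); f_a(n-1); ...; f_a(1)] *)
Fixpoint values (a n : nat) : seq nat :=
  match n with
  | 0 => [::]
  | 1 => [:: 1]
  | 2 => [:: a; 1]
  | m.+1 => next_value (values a m) :: values a m
  end.

(* Indices start at 1; the value f a 0 is irrelevant. *)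
Definition f (a n : nat) : nat := head 0 (values a n).

Definition eventually_identical (g h : nat -> nat) : Prop :=
  exists m, forall n, m < n -> g n = h n.

Lemma next_valueP (s : seq nat) :
  all (ltn 0) s ->
  admissible s (next_value s) /\
  (forall k, admissible s k -> next_value s <= k).
Proof.
move=> s_gt0; set b := head 1 s * sumn s.
have h_gt0 : 0 < head 1 s by case: s s_gt0 {b} => //= x s /andP[].
have adm_b : admissible s b.+1.
  rewrite /admissible ltn0Sn /=; apply/andP; split.
    apply/negP => sb.
    have : b.+1 <= sumn s.
      by rewrite sumnE (big_rem _ sb) /= leq_addr.
    by rewrite leqNgt ltnS leq_pmull.
  by rewrite -addn1 /b coprime_sym /coprime mulnC gcdnMDl gcdn1.
have has_adm : has (admissible s) (iota 0 b.+2).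
  by apply/hasP; exists b.+1; rewrite ?mem_iota ?ltnSn.
have lt_next : next_value s < b.+2.
  by rewrite -[X in _ < X](size_iota 0) -has_find.
split; first by move: (nth_find 0 has_adm); rewrite nth_iota.
move=> k adm_k; rewrite leqNgt; apply/negP => lt_k.
have := before_find 0 lt_k.
by rewrite nth_iota ?add0n ?adm_k // (ltn_trans lt_k).
Qed.

Lemma values_gt0 (a n : nat) : 0 < a -> all (ltn 0) (values a n).
Proof.
move=> a_gt0; elim: n => [|[|[|n]] IHn] //=; by rewrite a_gt0.
Qed.

Lemma mem_values (a n k : nat) :
  reflect (exists2 i, 0 < i <= n & k = f a i) (k \in values a n).
Proof.
have vS m : values a m.+1 = f a m.+1 :: values a m by case: m => [|[]].
elim: n => [|n IHn]; first by constructor=> -[[]].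
rewrite vS inE; apply: (iffP orP) => [[/eqP->|/IHn[i /andP[i0 le_in] ->]]|].
- by exists n.+1; rewrite ?leqnn.
- by exists i; rewrite ?i0 ?leqW.
case=> i /andP[i_gt0]; rewrite leq_eqVlt => /predU1P[->->|lt_in kE].
  by left.
by right; apply/IHn; exists i; rewrite ?i_gt0.
Qed.

Lemma f_1 (a : nat) : f a 1 = 1. Proof. by []. Qed.

Lemma f_2 (a : nat) : f a 2 = a. Proof. by []. Qed.

(* For n >= 3, f a n is the smallest positive integer that differs from
   f a 1, ..., f a (n - 1) and is coprime with f a (n - 1). *)
Lemma f_rec (a n : nat) : 0 < a -> 3 <= n ->
  let candidate k :=
    [/\ 0 < k, (forall i, 1 <= i < n -> k <> f a i) & coprime k (f a n.-1)] in
  candidate (f a n) /\ (forall k, candidate k -> f a n <= k).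
Proof.
case: n => [|[|[|n]]] // a_gt0 _ candidate.
have admP k : admissible (values a n.+2) k <-> candidate k.
  have hdE : head 1 (values a n.+2) = f a n.+2 by rewrite /f; case: n {candidate}.
  rewrite /admissible hdE; split.
    case/and3P=> k0 kNv co; split=> // i lt_i kE.
    by case/mem_values: kNv; exists i.
  case=> k0 kN co; apply/and3P; split=> //.
  by apply/mem_values => -[i lt_i]; apply: kN.
have [adm min] := next_valueP (values_gt0 n.+2 a_gt0).
by split=> [|k /admP]; [apply/admP | apply: min].
Qed.

(* Main.v *)
Require Import Defs.
From mathcomp Require Import all_boot.
From mathcomp Require Import zify.

(** The set of values taken so far and the current value determine the rest of
    the sequence ([stage_agree]), and only three shapes of state matter:
    - [ordered a n]: the used values are 1, ..., n and the current one is n;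
      from then on the sequence is the identity;
    - [lagging a m]: the used values are 1, ..., m + 1 and the current one is m;
    - [pending a m]: the same, except that a > m + 1 has been used as well.
    Let m be even and let d be the least prime not dividing m.  The least number
    above m + 1 that is coprime to m is m + d, and m + d is coprime to all of
    m + 1, ..., m + d - 1.  Hence a lagging sequence moves to m + d, comes back to
    m + 2, and runs through m + 3, ..., m + d - 1: it is then lagging at
    m + d - 1, which is even again ([lagging_step]).

    If a is odd, then 1, a, 2, 3, ..., a - 1 is lagging at a - 1; the sequence
    f_3 is of this kind.  If a is even and a > 2, the sequence soon becomes
    pending, and makes the same moves until m + d exceeds a; a short case
    distinction shows that it then becomes ordered or lagging ([pending_ends]).

    It remains to see that any two lagging sequences meet.  The map sending m to
    m + d - 1 never jumps over a primorial t.  If it did from m = t - j, all the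
    primes up to j + 1 would divide t - j.  If t is a multiple of these primes, a
    prime factor of j + 1 divides j, which is absurd; otherwise t itself would divide the
    smaller number t - j ([primorial_not_skipped]).  So every lagging sequence is
    lagging at all large primorials, where it agrees with f_3, and where it
    takes the value t at the index t + 1, unlike the identity. *)

(** * The recursion as a transition between states *)

Lemma values_succ a n : values a n.+1 = f a n.+1 :: values a n.
Proof. by case: n => [|[]]. Qed.

Lemma f_succP a n (s := values a n) : 0 < a -> 1 < n ->
  [/\ 0 < f a n.+1, f a n.+1 \notin s, coprime (f a n.+1) (f a n) &
      forall k, 0 < k -> k \notin s -> coprime k (f a n) -> f a n.+1 <= k].
Proof.
move=> a0 n1; have [[f0 fN fco] fmin] := f_rec (n := n.+1) a0 n1.
split=> //.
  by apply/mem_values => -[i /andP[i0 le_in]]; apply: fN; rewrite i0.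
move=> k k0 kN kco; apply: fmin; split=> // i /andP[i0 lt_in] kE.
by case/mem_values: kN; exists i; rewrite // i0.
Qed.

Lemma f_succ_unique a n k : 0 < a -> 1 < n ->
    0 < k -> k \notin values a n -> coprime k (f a n) ->
    (forall j, 0 < j < k -> j \notin values a n -> ~~ coprime j (f a n)) ->
  f a n.+1 = k.
Proof.
move=> a0 n1 k0 kN kco kmin; have [f0 fN fco fmin] := f_succP a n a0 n1.
apply/eqP; rewrite eqn_leq fmin //= leqNgt; apply/negP => lt_fk.
by have := kmin _ _ fN; rewrite f0 lt_fk fco => /(_ isT).
Qed.

(** After n terms the used values are 1, ..., l and the members of E, and the
    last term is c; E lists the few values taken ahead of their turn. *)
Definition stage a n l (E : seq nat) c :=
  [/\ 0 < a, 1 < n, f a n = c &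
      forall k, (k \in values a n) = (0 < k <= l) || (k \in E)].

Lemma stage_agree {a b n l E c} : stage a n l E c -> stage b n l E c ->
  forall k, n <= k -> f a k = f b k.
Proof.
case=> a0 n1 fa va [b0 _ fb vb] k.
suff H : n <= k -> f a k = f b k /\ values a k =i values b k by case/H.
elim: k => [|k IHk]; first by rewrite leqNgt ltnW.
rewrite leq_eqVlt => /predU1P[<-|lt_nk].
  by rewrite fa fb; split=> // k'; rewrite va vb.
have [fE vE] := IHk lt_nk; have k1 := leq_trans n1 lt_nk.
have [f0 fN fco fmin] := f_succP b k b0 k1.
have fE1 : f a k.+1 = f b k.+1.
  apply: f_succ_unique; rewrite ?vE ?fE // => j /andP[j0 lt_j].
  rewrite vE => jN; apply/negP => jco.
  by have := fmin _ j0 jN jco; rewrite leqNgt lt_j.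
by split=> // j; rewrite !values_succ !inE fE1 vE.
Qed.

Lemma stage_jump {a n l E c} x : stage a n l E c ->
    l < x -> x \notin E -> coprime x c ->
    (forall j, l < j < x -> ~~ coprime j c) ->
  stage a n.+1 l (x :: E) x.
Proof.
case=> a0 n1 fE vE lx xE xco xmin.
have fS : f a n.+1 = x.
  apply: f_succ_unique; rewrite ?fE // ?vE ?(negPf xE); try lia.
  move=> j jx; rewrite vE negb_or => /andP[jl _]; apply: xmin; lia.
split=> //; first exact: leqW.
by move=> k; rewrite values_succ !inE fS vE; lia.
Qed.

Lemma stage_absorb {a n l E c} : stage a n l (l.+1 :: E) c -> stage a n l.+1 E c.
Proof. by case=> a0 n1 fE vE; split=> // k; rewrite vE inE; lia. Qed.

Lemma stage_swap {a n l x y E c} :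
  stage a n l [:: x, y & E] c -> stage a n l [:: y, x & E] c.
Proof. by case=> a0 n1 fE vE; split=> // k; rewrite vE !inE (orbCA (k == x)). Qed.

Lemma stage_fill {a n l E c} : stage a n l E c ->
    l.+1 \notin E -> coprime l.+1 c ->
  stage a n.+1 l.+1 E l.+1.
Proof.
move=> st lE lco; apply: stage_absorb; apply: (stage_jump _ st) => // j. lia.
Qed.

Lemma stage_run {a n l E} r : stage a n l E l ->
    (forall j, l < j <= l + r -> j \notin E) ->
  stage a (n + r) (l + r) E (l + r).
Proof.
move=> st; elim: r => [|r IHr] rE; first by rewrite !addn0.
rewrite !addnS; apply: (stage_fill (c := l + r)).
- by apply: IHr => j jr; apply: rE; lia.
- by apply: rE; lia.
- exact: coprimeSn.
Qed.

(** When c is coprime to l + 1, all the free values below the extra value x can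
    be taken in order; the absorption of x leaves the sequence one step behind. *)
Lemma stage_catch_up {a n l E c x} : stage a n l (x :: E) c ->
    l.+1 < x -> (forall j, l < j < x -> j \notin E) -> coprime l.+1 c ->
  stage a (n + (x.-1 - l)) x E x.-1.
Proof.
case: x => [|x] //= st lx xE co.
have st1 : stage a n.+1 l.+1 (x.+1 :: E) l.+1.
  by apply: (stage_fill st) => //; rewrite inE negb_or xE; lia.
have := stage_run (x - l.+1) st1.
have -> : n.+1 + (x - l.+1) = n + (x - l) by lia.
have -> : l.+1 + (x - l.+1) = x by lia.
move=> st2; apply/stage_absorb/st2 => j jx.
by rewrite inE negb_or xE; lia.
Qed.

(** * The least prime not dividing a number *)

Definition least_nondivisor m d :=
  [/\ prime d, ~~ (d %| m) & forall p, prime p -> p < d -> p %| m].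

Lemma least_nondivisorP m : 0 < m -> exists d, least_nondivisor m d.
Proof.
move=> m0; pose P p := prime p && ~~ (p %| m).
have exP : exists p, P p.
  have [p lt_mp p_pr] := prime_above m.
  by exists p; rewrite /P p_pr gtnNdvd.
exists (ex_minn exP); case: ex_minnP => d /andP[d_pr dN] dmin.
split=> // p p_pr; apply: contraTT => pN.
by rewrite -leqNgt; apply: dmin; rewrite /P p_pr.
Qed.

Lemma coprime_by_primes x y : 0 < x ->
  (forall p, prime p -> p %| x -> p %| y -> False) -> coprime x y.
Proof.
move=> x0 H; rewrite /coprime eqn_leq gcdn_gt0 x0 andbT leqNgt.
apply/negP => /pdivP[p p_pr]; rewrite dvdn_gcd => /andP[px py].
exact: H p_pr px py.
Qed.

Section LeastNondivisor.
Variables (m d : nat).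
Hypothesis md : least_nondivisor m d.

Lemma least_nondivisor_coprime : coprime d m.
Proof. by case: md => d_pr dN _; rewrite prime_coprime. Qed.

Lemma least_nondivisor_min j : 1 < j < d -> ~~ coprime j m.
Proof.
case: md => _ _ dmin /andP[j1 jd].
have [p p_pr pj] := pdivP j1.
have p_le : p <= j by apply: dvdn_leq; lia.
apply/negP => /(coprime_dvdl pj).
by rewrite prime_coprime // dmin //; apply: leq_ltn_trans jd.
Qed.

(** A common prime factor p of m + i and m + d divides d - i, so it is less than
    d and divides m; it then divides the prime d, which is absurd. *)
Lemma least_nondivisor_shift i : 0 < i < d -> coprime (m + i) (m + d).
Proof.
case: md => d_pr _ dmin /andP[i0 lt_id]; apply: coprime_by_primes; first lia.
move=> p p_pr pi pd.
have pdi : p %| d - i by have := dvdn_sub pd pi; rewrite subnDl.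
have p_lt : p < d by have := dvdn_leq _ pdi; lia.
have := pd; rewrite dvdn_addr ?dmin // dvdn_prime2 // => /eqP pE.
by move: p_lt; rewrite pE ltnn.
Qed.

Lemma least_nondivisor_gt2 : ~~ odd m -> 2 < d.
Proof.
case: md => d_pr dN _ m_even; rewrite ltn_neqAle prime_gt1 // andbT.
by apply: contraNneq dN => <-; rewrite dvdn2.
Qed.

Lemma least_nondivisor_odd : ~~ odd m -> odd d.
Proof.
move/least_nondivisor_gt2; case: md => /even_prime[-> //|//].
Qed.

End LeastNondivisor.

(** * Lagging sequences *)

Definition ordered a n := stage a n n [::] n.
Definition lagging a m := stage a m.+1 m.+1 [::] m.
Definition pending a m := stage a m.+2 m.+1 [:: a] m.

(** Here E is empty for a lagging sequence and contains a for a pending one. *)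
Lemma stage_excursion {a n m d E} : stage a n m.+1 E m ->
    least_nondivisor m d -> 2 < d -> m + d \notin E ->
  stage a n.+1 m.+1 (m + d :: E) (m + d).
Proof.
move=> st md d2 dE; apply: (stage_jump _ st) => //; first lia.
  by rewrite coprime_sym /coprime gcdnDl gcdnC; apply: least_nondivisor_coprime.
move=> j jd; rewrite -(subnKC (m := m) (n := j)); last lia.
rewrite coprime_sym /coprime gcdnDl gcdnC.
by apply: (least_nondivisor_min _ _ md); lia.
Qed.

Lemma lagging_step {a m d} : ~~ odd m -> least_nondivisor m d ->
  lagging a m -> lagging a (m + d).-1.
Proof.
move=> m_even md st; have d2 := least_nondivisor_gt2 _ _ md m_even.
have st1 := stage_excursion st md d2 isT.
have co : coprime m.+2 (m + d).
  by rewrite -addn2; apply: least_nondivisor_shift md _ _.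
have := stage_catch_up st1 _ _ co; rewrite /lagging.
have -> : m.+2 + ((m + d).-1 - m.+1) = (m + d).-1.+1 by lia.
have -> : (m + d).-1.+1 = m + d by lia.
by apply=> //; lia.
Qed.

(** * Primorials *)

Definition primorial q := \prod_(0 <= p < q.+1 | prime p) p.

Lemma primorial0 : primorial 0 = 1.
Proof. by rewrite /primorial big_mkcond big_nat1. Qed.

Lemma primorialS q :
  primorial q.+1 = if prime q.+1 then primorial q * q.+1 else primorial q.
Proof.
rewrite /primorial !(big_mkcond prime) big_nat_recr //=.
by case: ifP; rewrite ?muln1.
Qed.

Lemma primorial_gt0 q : 0 < primorial q.
Proof. by apply: prodn_cond_gt0 => p /prime_gt0. Qed.

Lemma dvdn_primorial q p : prime p -> p <= q -> p %| primorial q.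
Proof.
move=> p_pr; elim: q => [|q IHq] le_pq; first by have := prime_gt0 p_pr; lia.
rewrite primorialS; have [pE|lt_pq] : p = q.+1 \/ p <= q by lia.
  by rewrite -pE p_pr dvdn_mull.
by case: ifP => _; rewrite ?dvdn_mulr // IHq.
Qed.

Lemma prime_dvd_primorial q p : prime p -> p %| primorial q -> p <= q.
Proof.
move=> p_pr; elim: q => [|q IHq].
  by rewrite primorial0 dvdn1; case: eqP p_pr => // ->.
rewrite primorialS; case: ifP => q_pr; last by move/IHq/leqW.
by rewrite Euclid_dvdM // (dvdn_prime2 p_pr q_pr) => /orP[/IHq/leqW //|/eqP ->].
Qed.

Lemma primorial_dvdP q x :
  (forall p, prime p -> p <= q -> p %| x) -> primorial q %| x.
Proof.
elim: q => [|q IHq] H.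
  by rewrite primorial0 dvd1n.
have dq : primorial q %| x by apply: IHq => p p_pr /leqW; apply: H.
rewrite primorialS; case: ifP => q_pr //; rewrite Gauss_dvd ?dq ?H //.
rewrite coprime_sym prime_coprime //; apply/negP => /(prime_dvd_primorial _ _ q_pr).
by rewrite ltnn.
Qed.

Lemma primorial_above n : exists2 q, 1 < q & n < primorial q.
Proof.
have [p lt_np p_pr] := prime_above n; exists p; first exact: prime_gt1.
apply: leq_trans lt_np _; apply: dvdn_leq; first exact: primorial_gt0.
exact: dvdn_primorial.
Qed.

Lemma primorial_not_skipped q m d : 0 < m < primorial q ->
  least_nondivisor m d -> (m + d).-1 <= primorial q.
Proof.
set t := primorial q => /andP[m0 lt_mt] [d_pr dN dmin].
rewrite leqNgt; apply/negP => lt_td.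
pose j := t - m; have tE : t = m + j by rewrite subnKC // ltnW.
have jd : j.+1 < d by lia.
have [le_jq|lt_qj] := leqP j.+1 q.
  have /pdivP[p p_pr pj] : 1 < j.+1 by lia.
  have pj_le := dvdn_leq (ltn0Sn j) pj.
  have pm : p %| m by apply: dmin => //; lia.
  have : p %| t by apply: dvdn_primorial => //; lia.
  rewrite tE dvdn_addr // => pj'.
  by move: pj; rewrite -addn1 dvdn_addr // dvdn1; case: eqP p_pr => // ->.
have : t %| m by apply: primorial_dvdP => p p_pr le_pq; apply: dmin => //; lia.
by move/dvdn_leq => /(_ m0); rewrite leqNgt lt_mt.
Qed.

Lemma lagging_primorial a m q : ~~ odd m -> 0 < m <= primorial q ->
  lagging a m -> lagging a (primorial q).
Proof.
have [k] := ubnP (primorial q - m); elim: k m => // k IHk m lt_k m_even /andP[m0].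
rewrite leq_eqVlt => /predU1P[->//|lt_mt] st.
have [d md] := least_nondivisorP m m0.
have d2 := least_nondivisor_gt2 _ _ md m_even.
have d_odd := least_nondivisor_odd _ _ md m_even.
apply: (IHk (m + d).-1); last exact: lagging_step.
- by lia.
- by lia.
- by rewrite primorial_not_skipped ?m0 // andbT; lia.
Qed.

(** * How each sequence starts *)

Lemma stage_init a : 1 < a -> stage a 2 1 [:: a] a.
Proof. by move=> a1; split=> //= [|k]; rewrite ?inE; lia. Qed.

Lemma ordered_id n : 1 < n -> ordered 2 n.
Proof.
move=> n1; have := stage_run (n - 2) (stage_absorb (stage_init 2 isT)).
by rewrite subnKC //; apply.
Qed.

Lemma lagging_odd a : 1 < a -> odd a -> lagging a a.-1.
Proof.
move=> a1 a_odd; have := stage_catch_up (stage_init a a1).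
rewrite /lagging coprime2n a_odd.
have -> : 2 + (a.-1 - 1) = a by lia.
have -> : a.-1.+1 = a by lia.
by apply=> //; lia.
Qed.

Lemma pending_even a : 2 < a -> ~~ odd a ->
  exists m, [/\ 0 < m, ~~ odd m, m.+1 < a & pending a m].
Proof.
move=> a2 a_even; have [d ad] := least_nondivisorP a (ltnW (ltnW a2)).
have d2 := least_nondivisor_gt2 _ _ ad a_even.
have d_odd := least_nondivisor_odd _ _ ad a_even.
have lt_da : d < a.
  (* a - 1 is coprime to a, so the prime factors of a - 1 do not divide a *)
  rewrite ltnNge; apply/negP => le_ad.
  have := least_nondivisor_min _ _ ad a.-1.
  have -> : coprime a.-1 a by rewrite coprimePn; lia.
  by move=> H; suff: false by []; apply: H; lia.
exists d.-1; split; try lia.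
have st1 : stage a 3 1 [:: d; a] d.
  apply: (stage_jump _ (stage_init a (ltnW a2))); first lia.
  - by rewrite inE neq_ltn lt_da.
  - exact: least_nondivisor_coprime.
  - exact: least_nondivisor_min.
have := stage_catch_up st1; rewrite /pending coprime2n d_odd.
have -> : 3 + (d.-1 - 1) = d.-1.+2 by lia.
have -> : d.-1.+1 = d by lia.
by apply=> // j jd; rewrite inE; lia.
Qed.

(** The odd number n - 1 is coprime to n + 3, but n + 2 may share the factor 3
    with it; this decides between an ordered sequence and a lagging one. *)
Lemma stage_after_even a n : ~~ odd n -> 0 < n -> stage a n.+1 n.+1 [::] n.-1 ->
  ordered a n.+2 \/ lagging a n.+2.
Proof.
move=> n_even n0 st; case: (boolP (coprime n.+2 n.-1)) => co.
  by left; apply: stage_fill st _ co.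
right; apply: stage_absorb.
have co3 : coprime n.+3 n.-1.
  have -> : n.+3 = n.-1 + 4 by lia.
  rewrite coprime_sym /coprime gcdnDl -/(coprime _ _) (@coprimeXr 2 _ 2) //.
  by rewrite coprimen2; lia.
apply: stage_fill (stage_jump n.+3 st _ _ _ _) _ _ => //.
- by move=> j jn; have -> : j = n.+2 by lia.
- by rewrite inE; lia.
- by rewrite coprimenS.
Qed.

Lemma pending_ends a m : ~~ odd a -> ~~ odd m -> 0 < m -> m.+1 < a ->
  pending a m ->
  (exists2 n, 1 < n & ordered a n) \/
  (exists m', [/\ 0 < m', ~~ odd m' & lagging a m']).
Proof.
move=> a_even.
have [k] := ubnP (a - m); elim: k m => // k IHk m lt_k m_even m0 lt_ma st.
have [d md] := least_nondivisorP m m0.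
have d2 := least_nondivisor_gt2 _ _ md m_even.
have d_odd := least_nondivisor_odd _ _ md m_even.
have st1 : stage a m.+3 m.+1 [:: m + d; a] (m + d).
  by apply: stage_excursion => //; rewrite inE; lia.
have co2 : coprime m.+2 (m + d).
  by rewrite -addn2; apply: least_nondivisor_shift md _ _.
have [lt_da|lt_ad] : m + d < a \/ a < m + d by lia.
  apply: (IHk (m + d).-1); try lia.
  have := stage_catch_up st1 _ _ co2; rewrite /pending.
  have -> : m.+3 + ((m + d).-1 - m.+1) = (m + d).-1.+2 by lia.
  have -> : (m + d).-1.+1 = m + d by lia.
  by apply=> [|j jd]; rewrite ?inE; lia.
have [aE|lt_ma2] : a = m.+2 \/ m.+2 < a by lia.
  (* a is the first value to come back to, so it is skipped at once *)
  have st2 : stage a m.+3 m.+2 [:: m + d] (m + d).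
    by move/stage_swap: st1; rewrite {2}aE => /stage_absorb.
  have [d3|d3] : d = 3 \/ 3 < d by lia.
    left; exists m.+3 => //.
    by move: st2; rewrite d3 addn3 => /stage_absorb.
  right; exists (m + d).-1; split; try lia.
  have := stage_catch_up st2; rewrite /lagging.
  have -> : m.+3 + ((m + d).-1 - m.+2) = (m + d).-1.+1 by lia.
  have -> : (m + d).-1.+1 = m + d by lia.
  apply=> //; first lia.
  by rewrite -addn3; apply: least_nondivisor_shift md _ _.
(* the sequence comes back to m + 2 and runs up to a - 1 *)
have st2 : stage a a.+1 a [:: m + d] a.-1.
  have := stage_catch_up (stage_swap st1) lt_ma2 _ co2.
  have -> : m.+3 + (a.-1 - m.+1) = a.+1 by lia.
  by apply=> j ja; rewrite inE; lia.
have [aE|lt_ad1] : m + d = a.+1 \/ a.+1 < m + d by lia.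
  have a0 : 0 < a by lia.
  have {}st2 : stage a a.+1 a.+1 [::] a.-1 by move: st2; rewrite aE => /stage_absorb.
  have [ord|lag] := stage_after_even _ _ a_even a0 st2.
    by left; exists a.+2.
  by right; exists a.+2; rewrite /= negbK.
right; exists (m + d).-1; split; try lia.
have := stage_catch_up st2; rewrite /lagging.
have -> : a.+1 + ((m + d).-1 - a) = (m + d).-1.+1 by lia.
have -> : (m + d).-1.+1 = m + d by lia.
apply=> //; have -> : a.+1 = a.-1 + 2 by lia.
by rewrite coprime_sym /coprime gcdnDl -/(coprime _ _) coprimen2; lia.
Qed.

(** * The two classes *)

Lemma ordered_or_lagging a : 1 < a ->
  (exists2 n, 1 < n & ordered a n) \/
  (exists m, [/\ 0 < m, ~~ odd m & lagging a m]).
Proof.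
move=> a1; case: (boolP (odd a)) => [a_odd|a_even].
  by right; exists a.-1; split; [lia | lia | exact: lagging_odd].
have [->|a2] : a = 2 \/ 2 < a by lia.
  by left; exists 2; last exact: ordered_id.
have [m [m0 m_even lt_ma st]] := pending_even _ a2 a_even.
exact: pending_ends st.
Qed.

Lemma lagging_f3_primorial q : 1 < q -> lagging 3 (primorial q).
Proof.
move=> q1; apply: (lagging_primorial _ 2) (lagging_odd 3 isT isT) => //=.
by rewrite dvdn_leq ?primorial_gt0 // dvdn_primorial.
Qed.

Theorem mainTheorem2 :
  ~ eventually_identical (f 2) (f 3) /\
  (forall a : nat, 2 <= a ->
     eventually_identical (f a) (f 2) \/ eventually_identical (f a) (f 3)).
Proof.
split=> [[m fE]|a a1].
  have [q q1 lt_mt] := primorial_above m.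
  have [_ t1 f3 _] := lagging_f3_primorial _ q1.
  have [_ _ f2 _] := ordered_id _ t1.
  by have := fE _ (leqW lt_mt); rewrite f2 f3; lia.
have [[n n1 st]|[m [m0 m_even st]]] := ordered_or_lagging _ a1.
  left; exists n => k /ltnW; exact: (stage_agree st (ordered_id _ n1)).
have [q q1 lt_mt] := primorial_above m.
have {}st : lagging a (primorial q).
  by apply: lagging_primorial st => //; rewrite m0 ltnW.
right; exists (primorial q); exact: stage_agree st (lagging_f3_primorial _ q1).
Qed.
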